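(* A topological space $X$ can be embedded (as a topological subspace) in a metrizable topological group $G$ with $\operatorname{ind} G=0$ if and only if the topology of $X$ is generated by a uniformity on $X$ which has a countable base consisting of open-and-closed sets (that is, open-and-closed subsets of $X\times X$).
   Context: Uniformities are understood in the sense of Engelking's ''General Topology'': a uniformity on $X$ is a family of entourages, i.e. symmetric subsets of $X\times X$ containing the diagonal, satisfying the usual axioms, including that the intersection of all entourages is the diagonal (so the generated topology is Hausdorff). $\operatorname{ind}$ is the small inductive dimension; $\operatorname{ind} G=0$ means that $G$ is nonempty and has a base of open-and-closed sets. The sets in the base of the uniformity are entourages, and ''open-and-closed'' refers to the product topology on $X\times X$. *)

(* Defs.v *)
From HB Require Import structures.
From mathcomp Require Import all_boot all_order all_algebra.
From mathcomp Require Import all_classical all_reals all_analysis.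

Set Implicit Arguments.
Unset Strict Implicit.
Unset Printing Implicit Defensive.

Local Open Scope classical_set_scope.

HB.mixin Record isTopologicalGroup G & Topological G & monoid.Group G := {
  mulg_continuous : continuous (fun xy : G * G => (xy.1 * xy.2)%g);
  invg_continuous : continuous (fun x : G => (x^-1)%g)
}.

#[short(type="topologicalGroupType")]
HB.structure Definition TopologicalGroup :=
  {G of Topological G & monoid.Group G & isTopologicalGroup G}.

Definition is_metric (R : realType) (T : Type) (d : T -> T -> R) : Prop :=
  [/\ forall x y, (0 <= d x y)%R,
      forall x y, d x y = 0%R <-> x = y,
      forall x y, d x y = d y x &
      forall x y z, (d x z <= d x y + d y z)%R].

Definition metrizable (R : realType) (T : topologicalType) : Prop :=
  exists2 d : T -> T -> R, is_metric d &
    forall A : set T, open A <->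
      forall x, A x ->
        exists2 e : R, (0 < e)%R & [set y | (d x y < e)%R] `<=` A.

Definition ind_zero (T : topologicalType) : Prop :=
  [set: T] !=set0 /\ exists2 B : set_system T, basis B & B `<=` clopen.

(* The second clause says that X carries the topology induced by f. *)
Definition topological_embedding (X Y : topologicalType) (f : X -> Y) : Prop :=
  injective f /\
  forall A : set X, open A <-> exists2 B : set Y, open B & A = f @^-1` B.

Section Uniformity.
Local Open Scope relation_scope.

(* Uniformities follow Engelking's "General Topology": unlike the entourages of
   uniformType, entourages are symmetric, and a uniformity is separating. *)
Definition is_entourage (X : Type) (V : set (X * X)) : Prop :=
  diagonal `<=` V /\ V^-1 = V.

Record is_uniformity (X : Type) (U : set_system (X * X)) : Prop := {
  uniformity_nonempty : U !=set0;
  uniformity_entourage : U `<=` @is_entourage X;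
  uniformity_up : forall V W, U V -> is_entourage W -> V `<=` W -> U W;
  uniformity_setI : forall V W, U V -> U W -> U (V `&` W);
  uniformity_split : forall V, U V -> exists2 W, U W & W \; W `<=` V;
  uniformity_separated : \bigcap_(V in U) V = diagonal
}.

End Uniformity.

Definition uniformity_base (X : Type) (U B : set_system (X * X)) : Prop :=
  B `<=` U /\ forall V, U V -> exists2 W, B W & W `<=` V.

Definition generates_topology
    (X : topologicalType) (U : set_system (X * X)) : Prop :=
  forall A : set X, open A <->
    forall x, A x -> exists2 V, U V & xsection V x `<=` A.

(* Main.v *)
Require Import Defs.
From HB Require Import structures.
From mathcomp Require Import all_boot all_order all_algebra.
From mathcomp Require Import all_classical all_reals all_analysis.
From mathcomp Require Import ring lra zify.

(** From a group to a uniformity: if G is metrizable with ind G = 0, the unit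
    has a sequence C n of clopen neighborhoods forming a base, and the sets of
    pairs (x, y) for which both quotients of f x and f y lie in C n are a
    clopen base of a uniformity inducing the topology of X.

    From a uniformity to a group: a countable clopen base gives clopen
    entourages V 0 = X * X, V 1, ... with V (n+1) composed with itself three
    times inside V n.  Put g x y = (6/7)^n where n is the last index with
    (x, y) in V n.  This g is not a metric, but g^4 is equivalent to its chain
    pseudometric up to the factor 2 (Frink), and g is locally constant off the
    diagonal because the V n are clopen ([uniform_scale_loc]).

    The group is the Boolean group X -> bool, where x is sent to the
    characteristic function of {x}.  A finite set p is near 0 when it is a sum
    modulo 2 of pairs {a_j, b_j} carrying weights c_j of small total weight,
    c_j^4 bounding the length of some chain from a_j to b_j.  This is a Graev
    norm, hence it gives a metrizable group topology inducing the topology of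
    X, but nothing makes its balls closed.

    The clopen neighborhoods come from a greedy procedure: repeatedly cancel
    the two closest points of a finite set, paying their distance g, until
    nothing is left.  The sets p that can be exhausted at a cost less than d
    ([greedy_ball]) are a base at 0, and they are clopen.  Indeed, let u be
    finite and p a sum of pairs of tiny total weight W.  On u + p the procedure
    cancels the points of p first: as long as some are left, the closest
    points are much closer to each other than the points of u are.  This first
    phase costs at most 3 W and leaves a copy of u in which each point has
    moved slightly ([perturbation_step]).  As g is locally constant off the
    diagonal, from then on the procedure acts exactly as on u.  Thus u can be
    exhausted at a cost less than d if and only if u + p can
    ([greedy_perturb], [greedy_unperturb]).

    The point is that the first phase is cheap, although greedy matchings are
    in general much worse than optimal ones.  When the cancelled points x, y
    belong to pairs {a, x}, {y, b} of weights c <= d, the remaining points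
    a, b form a new pair.  As g x y is at most g a x and g y b, a chain joining
    a to b has length at most c^4 + d^4 + 2 c^4 <= (d + c/2)^4, so d + c/2 is
    an admissible weight for the new pair, and the loss c/2 in total weight
    pays for the cancellation ([merge_chains]).  The fourth power serves to
    make this inequality true. *)

Set Implicit Arguments.
Unset Strict Implicit.
Unset Printing Implicit Defensive.
Import Order.TTheory GRing.Theory Num.Theory.
Local Open Scope classical_set_scope.
Local Open Scope ring_scope.

(** * Sequences up to permutation *)

Lemma perm_map_inv (T U : eqType) (f : T -> U) (s : seq T) (t : seq U) :
  perm_eq (map f s) t -> exists2 s', perm_eq s s' & t = map f s'.
Proof.
case: s => [|a s] P; first by exists [::] => //; apply/perm_nilP; rewrite perm_sym.
rewrite perm_sym in P; have [I IE ->] := perm_iotaP (f a) P.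
rewrite size_map in IE.
exists [seq nth a (a :: s) i | i <- I].
  by rewrite perm_sym -{2}[a :: s](mkseq_nth a) /mkseq; exact: perm_map.
rewrite -map_comp; apply/eq_in_map => i.
rewrite (perm_mem IE) mem_iota => /andP[_ iI].
by rewrite (nth_map a).
Qed.

Section PermFacts.
Context {T : eqType}.
Implicit Types (r s u : seq T) (x y a b : T).

Lemma perm_cons_cases s u a b : perm_eq (a :: u) (b :: s) ->
  (a = b /\ perm_eq u s) \/
  exists r, perm_eq u (b :: r) /\ perm_eq s (a :: r).
Proof.
have [->|ab] := eqVneq a b; first by rewrite perm_cons; left.
move=> P; right.
have bw : b \in u.
  by have := perm_mem P b; rewrite !inE eqxx eq_sym (negbTE ab).
exists (rem b u); split; first exact: perm_to_rem.
rewrite -(perm_cons b); apply: perm_trans (_ : perm_eq (a :: b :: rem b u) _).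
  by rewrite perm_sym in P; apply: perm_trans P _; rewrite perm_cons perm_to_rem.
by apply/permP => p /=; lia.
Qed.

Lemma perm_doubleP r s a x : a != x ->
  perm_eq [:: a, a & r] [:: x, x & s] ->
  exists r', perm_eq r [:: x, x & r'] /\ perm_eq s [:: a, a & r'].
Proof.
move=> ax; have ne : (a = x) -> False by move/eqP: ax.
case/perm_cons_cases => [[/ne//]|[r1 []]].
case/perm_cons_cases => [[/ne//]|[r2 [rE r1E]]].
case/perm_cons_cases => [[/esym/ne//]|[r3 [sE]]].
rewrite perm_sym in r1E => /(perm_trans r1E).
case/perm_cons_cases => [[/ne//]|[r4 [r2E r3E]]].
exists r4; split; first by apply: perm_trans rE _; rewrite perm_cons.
by apply: perm_trans sE _; rewrite perm_cons.
Qed.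

Lemma perm_swap1 s u x y b : perm_eq s (b :: u) ->
  perm_eq [:: x, y & s] [:: x, b, y & u].
Proof. by move=> /permP P; apply/permP => p; rewrite /= P /=; lia. Qed.

Lemma perm_swap2 s u x y b : perm_eq s (b :: u) ->
  perm_eq [:: x, y & s] [:: y, b, x & u].
Proof. by move=> /permP P; apply/permP => p; rewrite /= P /=; lia. Qed.

Lemma perm_swap_head s u a b : perm_eq s (b :: u) ->
  perm_eq (a :: s) [:: b, a & u].
Proof. by move=> /permP P; apply/permP => p; rewrite /= P /=; lia. Qed.

Lemma perm_cat_middle2 s u a b : perm_eq (s ++ [:: a, b & u]) [:: a, b & s ++ u].
Proof. by rewrite perm_sym (perm_catCA [:: a; b] s u). Qed.

End PermFacts.

(** * Chains *)

(** The fourth power is one with which greedy merging of pairs loses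
    weight, see [merge_weights].  The last field is the hypothesis of Frink's
    metrization lemma for [g ^ 4]. *)
Record frink_scale (R : realType) (X : Type) (g : X -> X -> R) : Prop := {
  scale_ge0 : forall x y, 0 <= g x y;
  scale_eq0 : forall x y, g x y = 0 <-> x = y;
  scale_sym : forall x y, g x y = g y x;
  scale_frink : forall (M : R) a b c d,
    g a b ^+ 4 <= M -> g b c ^+ 4 <= M -> g c d ^+ 4 <= M ->
    g a d ^+ 4 <= 2 * M
}.

Section Chains.
Context {R : realType} {X : choiceType} (g : X -> X -> R).

(** [chained t a b] plays the part of an upper bound t for the chain
    pseudometric of [g ^ 4]; no infimum has to be taken. *)
Inductive chained : R -> X -> X -> Prop :=
| chained_edge t a b : g a b ^+ 4 <= t -> chained t a b
| chained_trans s t a b c :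
    chained s a b -> chained t b c -> chained (s + t) a c.

Lemma chained_le s t a b : s <= t -> chained s a b -> chained t a b.
Proof.
move=> st ch; elim: ch t st => {s a b} [s a b gs|s1 s2 a b c ch1 _ _ IH] t st.
  by apply: chained_edge; exact: le_trans st.
by rewrite -(subrKC s1 t); apply: chained_trans ch1 (IH _ _); lra.
Qed.

Fixpoint path_length (x : X) (p : seq X) : R :=
  if p is y :: p' then g x y ^+ 4 + path_length y p' else 0.

Lemma path_length_cat x p q :
  path_length x (p ++ q) = path_length x p + path_length (last x p) q.
Proof. by elim: p x => [|y p IH] x /=; rewrite ?add0r// IH addrA. Qed.

Lemma chained_path t a b : chained t a b ->
  exists p, last a p = b /\ path_length a p <= t.
Proof.
elim=> {t a b} [t a b gt|s t a b c _ [p [<- ps]] _ [q [<- qt]]].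
  by exists [:: b]; split => //=; rewrite addr0.
by exists (p ++ q); rewrite last_cat path_length_cat lerD.
Qed.

Section Scale.
Hypothesis gS : frink_scale g.

Lemma gxx x : g x x = 0. Proof. exact/(scale_eq0 gS). Qed.

Lemma g4_ge0 x y : 0 <= g x y ^+ 4.
Proof. by rewrite exprn_ge0 ?scale_ge0. Qed.

Lemma path_length_ge0 x p : 0 <= path_length x p.
Proof. by elim: p x => //= y p IH x; rewrite addr_ge0 ?g4_ge0. Qed.

Lemma chained_refl t a : 0 <= t -> chained t a a.
Proof. by move=> t0; apply: chained_edge; rewrite gxx expr0n. Qed.

Lemma chained_sym t a b : chained t a b -> chained t b a.
Proof.
elim=> {t a b} [t a b gt|s t a b c _ ch1 _ ch2].
  by apply: chained_edge; rewrite (scale_sym gS).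
by rewrite addrC; exact: chained_trans ch2 ch1.
Qed.

(** Cut at the first step after which at most [k] remains: one step earlier
    more than [k] remained, so what precedes this step is at most [h]. *)
Lemma split_path (h k : R) x p : p != [::] -> 0 <= h -> 0 <= k ->
  path_length x p <= h + k ->
  exists p1 y p2, [/\ p = p1 ++ y :: p2, path_length x p1 <= h &
    path_length y p2 <= k].
Proof.
move=> + + k0; elim: p h x => //= y p IH h x _ h0 len.
case: (leP (path_length y p) k) => [pk|kp]; first by exists [::], y, p.
have p0 : p != [::] by apply: contraTneq kp => ->/=; rewrite -leNgt.
have [//|||p1 [z [p2 [-> l1 l2]]]] := IH (h - g x y ^+ 4) y; [lra|lra|].
by exists (y :: p1), z, p2; split => //=; lra.
Qed.

(** Frink's argument: cut the path at half of its length t.  By induction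
    both parts have end points at [g ^ 4] at most t, the middle step too, and
    the three-step inequality gives 2 t. *)
Lemma scale_path a p : g a (last a p) ^+ 4 <= 2 * path_length a p.
Proof.
have [n] := ubnP (size p); elim: n a p => // n IH a p szp.
have [->/=|p0] := eqVneq p [::]; first by rewrite gxx expr0n mulr0.
have t0 := path_length_ge0 a p; set t := path_length a p in t0 *.
have [||| p1 [y [p2 [pE l1 l2]]]] :=
  @split_path (t / 2) (t / 2) a p p0; rewrite -/t; [lra|lra|lra|].
move: szp; rewrite pE size_cat /= ltnS => szp.
rewrite last_cat /=; apply: (@scale_frink _ _ _ gS t _ (last a p1) y).
- by apply: le_trans (IH _ _ _) _; [lia|lra].
- rewrite /t pE path_length_cat /=.
  by have := path_length_ge0 a p1; have := path_length_ge0 y p2; lra.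
- by apply: le_trans (IH _ _ _) _; [lia|lra].
Qed.

Lemma scale_chained t a b : chained t a b -> g a b ^+ 4 <= 2 * t.
Proof.
by move=> /chained_path[p [<- pt]]; apply: le_trans (scale_path a p) _; lra.
Qed.

End Scale.
End Chains.

(** * Greedy cancellation *)

Section Greedy.
Context {R : realType} {X : choiceType} (g : X -> X -> R).

(** Quantifying over rearrangements of [w] selects two distinct positions,
    so that repeated points count as pairs at distance 0. *)
Definition closest (w : seq X) (x y : X) : Prop :=
  forall a b r, perm_eq w (a :: b :: r) -> g x y <= g a b.

(** The closest pair need not be unique; [greedy w t] says that some run of
    the procedure exhausts [w] at total cost [t]. *)
Inductive greedy : seq X -> R -> Prop :=
| greedy_nil : greedy [::] 0
| greedy_cons w x y s t : perm_eq w (x :: y :: s) -> closest w x y ->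
    greedy s t -> greedy w (g x y + t).

Lemma closest_perm w w' x y : perm_eq w w' -> closest w x y -> closest w' x y.
Proof. by move=> ww' cl a b r w'E; apply: cl (perm_trans ww' w'E). Qed.

Lemma greedy_perm w w' t : perm_eq w w' -> greedy w t -> greedy w' t.
Proof.
move=> ww' G; case: G ww' => {w t} [|w x y s t wE cl G] ww'.
  by move: ww'; rewrite perm_sym => /perm_nilP ->; exact: greedy_nil.
apply: greedy_cons (closest_perm ww' cl) G.
by apply: perm_trans wE; rewrite perm_sym.
Qed.

Lemma seq_min (T : eqType) (h : T -> R) (D : seq T) : D != [::] ->
  exists2 m, m \in D & forall d, d \in D -> h m <= h d.
Proof.
elim: D => // a D IH _; have [->|/IH[m mD mP]] := eqVneq D [::].
  by exists a => [|d]; rewrite ?inE// => /eqP ->.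
have [am|ma] := leP (h a) (h m).
  exists a; rewrite ?mem_head// => d; rewrite inE => /predU1P[->//|/mP].
  exact: le_trans.
exists m; first by rewrite inE mD orbT.
by move=> d; rewrite inE => /predU1P[->|/mP//]; exact: ltW.
Qed.

Lemma closest_exists (w : seq X) : (1 < size w)%N ->
  exists x y s, perm_eq w (x :: y :: s) /\ closest w x y.
Proof.
move=> w1; pose D := [seq (a, b) | a <- w, b <- rem a w].
have DP a b r : perm_eq w (a :: b :: r) -> (a, b) \in D.
  move=> wE; have aw : a \in w by rewrite (perm_mem wE) mem_head.
  apply/allpairsPdep; exists a, b; split => //.
  have : perm_eq (a :: rem a w) (a :: b :: r).
    by apply: perm_trans wE; rewrite perm_sym perm_to_rem.
  by rewrite perm_cons => /perm_mem ->; rewrite mem_head.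
have [|[x y] /allpairsPdep[x' [y' [xw yw [-> ->]]]] mP] :=
    @seq_min _ (fun p => g p.1 p.2) D.
  by case: w w1 {DP} @D => [|a [|b r]]//= _; rewrite eqxx.
exists x', y', (rem y' (rem x' w)); split.
  by apply: perm_trans (perm_to_rem xw) _; rewrite perm_cons perm_to_rem.
by move=> a b r /DP /mP.
Qed.

Section Scale.
Hypothesis gS : frink_scale g.

Lemma greedy_ge0 s t : greedy s t -> 0 <= t.
Proof. by elim=> // *; rewrite addr_ge0 ?(scale_ge0 gS). Qed.

Lemma greedy_double x s t : greedy s t -> greedy [:: x, x & s] t.
Proof.
move=> G; rewrite -(add0r t) -(gxx gS x); apply: greedy_cons G => // a b r _.
by rewrite (gxx gS) (scale_ge0 gS).
Qed.

(** Equal points are at distance 0, so the first move of any run cancels a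
    pair of equal points; either it is this one, or the induction hypothesis
    applies to what remains. *)
Lemma greedy_undouble x s t : greedy [:: x, x & s] t -> greedy s t.
Proof.
suff H w u : greedy w u ->
    forall x s, perm_eq w [:: x, x & s] -> greedy s u.
  by move=> G; exact: H G _ _ (perm_refl _).
move=> G; elim: G => {w u x s t} [|w a b r t wE cl G IH] x s.
  by move=> /perm_size.
move=> xw.
have gab : g a b = 0.
  apply/eqP; rewrite eq_le (scale_ge0 gS) andbT -(gxx gS x).
  exact: cl xw.
have ab : a = b by apply/(scale_eq0 gS).
subst b; rewrite (gxx gS) add0r.
have P : perm_eq [:: a, a & r] [:: x, x & s].
  by rewrite perm_sym in wE; exact: perm_trans wE xw.
have [ax|ax] := eqVneq a x.
  by subst x; move: P; rewrite !perm_cons => rs; exact: greedy_perm rs G.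
have [r' [rE sE]] := perm_doubleP ax P.
by apply: greedy_perm (greedy_double a (IH _ _ rE)); rewrite perm_sym.
Qed.

End Scale.
End Greedy.

(** * Weighted pairs *)

Section Matching.
Context {R : realType} {X : choiceType} (g : X -> X -> R).

Definition ends (L : seq (X * X * R)) : seq X :=
  flatten [seq [:: e.1.1; e.1.2] | e <- L].

Definition weight (L : seq (X * X * R)) : R := \sum_(e <- L) e.2.

Definition matching (L : seq (X * X * R)) : Prop :=
  forall e, e \in L -> 0 <= e.2 /\ chained g (e.2 ^+ 4) e.1.1 e.1.2.

Lemma ends_cons e L : ends (e :: L) = [:: e.1.1, e.1.2 & ends L].
Proof. by []. Qed.

Lemma ends_cat L L' : ends (L ++ L') = ends L ++ ends L'.
Proof. by rewrite /ends map_cat flatten_cat. Qed.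

Lemma weight_cons e L : weight (e :: L) = e.2 + weight L.
Proof. by rewrite /weight big_cons. Qed.

Lemma weight_cat L L' : weight (L ++ L') = weight L + weight L'.
Proof. by rewrite /weight big_cat. Qed.

Lemma matching_cons a b c L : 0 <= c -> chained g (c ^+ 4) a b ->
  matching L -> matching ((a, b, c) :: L).
Proof. by move=> c0 ch mL e; rewrite inE => /predU1P[->|/mL]. Qed.

Lemma matching_cat L L' : matching L -> matching L' -> matching (L ++ L').
Proof. by move=> mL mL' e; rewrite mem_cat => /orP[/mL|/mL']. Qed.

Lemma matching_behead e L : matching (e :: L) -> matching L.
Proof. by move=> mL e' e'L; apply: mL; rewrite inE e'L orbT. Qed.

Lemma weight_ge0 L : matching L -> 0 <= weight L.
Proof. by move=> mL; rewrite /weight big_seq sumr_ge0// => e /mL[]. Qed.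

Section Scale.
Hypothesis gS : frink_scale g.

(** [L] is, up to order and orientation, the pair of [x] and [b] with weight
    [c] together with [L']. *)
Definition partner (L : seq (X * X * R)) x b c L' : Prop :=
  [/\ matching L', 0 <= c, chained g (c ^+ 4) x b, weight L = c + weight L' &
      size L = (size L').+1 /\ perm_eq (ends L) [:: x, b & ends L']].

Lemma partner_exists L x : matching L -> x \in ends L ->
  exists b c L', partner L x b c L'.
Proof.
elim: L => // e L IH mL; rewrite ends_cons !inE.
have [e0 ech] := mL e (mem_head _ _); have mL' := matching_behead mL.
have [->|xa] := eqVneq x e.1.1.
  by move=> _; exists e.1.2, e.2, L; split; rewrite ?weight_cons ?ends_cons.
have [->|xb] := eqVneq x e.1.2.
  move=> _; exists e.1.1, e.2, L; split; rewrite ?weight_cons ?ends_cons//.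
    exact: chained_sym ech.
  split => //.
  by apply/permP => p /=; lia.
move=> /= /(IH mL')[b [c [L' [mL'' c0 ch wE [szE P]]]]].
exists b, c, (e :: L'); split => //.
- by move=> e'; rewrite inE => /predU1P[->|/mL''].
- by rewrite !weight_cons wE; lra.
- split; first by rewrite /= szE.
  rewrite !ends_cons; apply/permP => p /=; move/permP: P => /(_ p) /= ->; lia.
Qed.

Lemma pick_endpoint (zs : seq (X * X)) L x s : matching L ->
  perm_eq (map snd zs ++ ends L) (x :: s) ->
  (exists z zs', [/\ perm_eq zs (z :: zs'), z.2 = x &
      perm_eq s (map snd zs' ++ ends L)]) \/
  (exists b c L', partner L x b c L' /\
      perm_eq s (b :: (map snd zs ++ ends L'))).
Proof.
move=> mL P; have : x \in map snd zs ++ ends L by rewrite (perm_mem P) mem_head.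
rewrite mem_cat => /orP[/mapP[z zzs xz]|/(partner_exists mL)[b [c [L' pL]]]].
  left; exists z, (rem z zs); split => //; first exact: perm_to_rem.
  rewrite -(perm_cons x) perm_sym; apply: perm_trans P.
  by rewrite xz -cat_cons -map_cons perm_cat2r perm_map// perm_sym perm_to_rem.
right; exists b, c, L'; split => //; case: pL => _ _ _ _ [_ eL].
apply/permP => p; move/permP: P => /(_ p); move/permP: eL => /(_ p).
rewrite /= !count_cat /=; lia.
Qed.

Lemma le_of_pow4 (a b : R) : 0 <= a -> 0 <= b -> a ^+ 4 <= b ^+ 4 -> a <= b.
Proof. by move=> a0 b0; rewrite ler_pXn2r. Qed.

(** With d = c + k the difference is a polynomial in c and k with
    nonnegative coefficients.  For the exponents 1, 2, 3 it fails at c = d. *)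
Lemma merge_weights (c d : R) : 0 <= c -> c <= d ->
  3 * c ^+ 4 + d ^+ 4 <= (d + c / 2) ^+ 4.
Proof.
move=> c0 cd.
have [k k0 ->] : exists2 k, 0 <= k & d = c + k.
  by exists (d - c); [lra|ring].
rewrite -subr_ge0.
have -> : (c + k + c / 2) ^+ 4 - (3 * c ^+ 4 + (c + k) ^+ 4) =
  (17/16) * c ^+ 4 + (19/2) * (c ^+ 3 * k) + (15/2) * (c ^+ 2 * k ^+ 2)
   + 2 * (c * k ^+ 3) by field.
by rewrite !addr_ge0// mulr_ge0// ?mulr_ge0 ?exprn_ge0//; lra.
Qed.

Lemma small_edge x y (c : R) : 0 <= c -> g x y ^+ 4 <= 2 * c ^+ 4 ->
  g x y <= 3 / 2 * c.
Proof.
move=> c0 G; apply: le_of_pow4; [exact: (scale_ge0 gS)|by lra|].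
apply: le_trans G _; rewrite exprMn; apply: ler_wpM2r; first exact: exprn_ge0.
by lra.
Qed.

(** A greedy move on [x] and [y] leaves [a] and [b] unpaired.  Since [g x y] is
    bounded by the smaller of the two old weights, the new weight saves half of
    that weight, and a third of [g x y] can be charged to what is saved. *)
Lemma merge_chains a x y b c d : 0 <= c -> 0 <= d ->
  chained g (c ^+ 4) a x -> chained g (d ^+ 4) y b ->
  g x y <= g a x -> g x y <= g y b ->
  exists w, [/\ 0 <= w, chained g (w ^+ 4) a b & w + g x y / 3 <= c + d].
Proof.
move=> c0 d0 ch1 ch2 g1 g2.
have g0 := scale_ge0 gS x y.
have G1 : g x y ^+ 4 <= 2 * c ^+ 4.
  apply: le_trans (scale_chained gS ch1).
  by rewrite ler_pXn2r ?nnegrE ?(scale_ge0 gS).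
have G2 : g x y ^+ 4 <= 2 * d ^+ 4.
  apply: le_trans (scale_chained gS ch2).
  by rewrite ler_pXn2r ?nnegrE ?(scale_ge0 gS).
(* the chain a, ..., x, y, ..., b *)
have ch : chained g (c ^+ 4 + (g x y ^+ 4 + d ^+ 4)) a b.
  apply: chained_trans ch1 _; apply: chained_trans ch2; exact: chained_edge.
case: (leP c d) => [cd|/ltW dc].
  exists (d + c / 2); split; first by lra.
    by apply: chained_le ch; have := merge_weights c0 cd; lra.
  by have := small_edge c0 G1; lra.
exists (c + d / 2); split; first by lra.
  by apply: chained_le ch; have := merge_weights d0 dc; lra.
by have := small_edge d0 G2; lra.
Qed.

End Scale.
End Matching.

(** * Cancellation in a perturbed set *)

Section Reduction.
Context {R : realType} {X : choiceType} (g : X -> X -> R).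
Hypothesis gS : frink_scale g.

(** The number e is so small that moving the points of [xs] by less than e
    changes none of their mutual distances, which are at least e. *)
Definition well_separated (e : R) (xs : seq X) : Prop :=
  forall a b s, perm_eq xs [:: a, b & s] ->
  forall a' b', g a a' < e -> g b b' < e -> g a' b' = g a b /\ e <= g a b.

(** The points of [w] are copies [z.2] of the points [z.1] of [xs], each reached
    by a chain of length at most [r], and the end points of [n] pairs of total
    weight [W]. *)
Definition perturbation n (xs w : seq X) (r W : R) : Prop :=
  exists (zs : seq (X * X)) L,
  [/\ perm_eq (map fst zs) xs, perm_eq w (map snd zs ++ ends L),
      forall z, z \in zs -> chained g r z.1 z.2, matching g L &
      weight L = W /\ size L = n].

Lemma chained_lt (e r : R) x y : 0 <= e -> 2 * r < e ^+ 4 ->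
  chained g r x y -> g x y < e.
Proof.
move=> e0 re /(scale_chained gS) gr; rewrite ltNge; apply/negP => eg.
by have : e ^+ 4 <= g x y ^+ 4; [rewrite ler_pXn2r ?nnegrE ?(scale_ge0 gS)|lra].
Qed.

Lemma separated_far (e r : R) xs zs z z' s : 0 <= e -> 2 * r < e ^+ 4 ->
  well_separated e xs -> perm_eq (map fst zs) xs ->
  (forall z, z \in zs -> chained g r z.1 z.2) ->
  perm_eq zs [:: z, z' & s] ->
  g z.2 z'.2 = g z.1 z'.1 /\ e <= g z.1 z'.1.
Proof.
move=> e0 re sep zx zr zE.
have zz : z \in zs by rewrite (perm_mem zE) mem_head.
have zz' : z' \in zs by rewrite (perm_mem zE) !inE eqxx orbT.
apply: (sep _ _ (map fst s)).
- rewrite perm_sym in zx; apply: perm_trans zx _; exact: perm_map zE.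
- exact: chained_lt re (zr _ zz).
- exact: chained_lt re (zr _ zz').
Qed.

(** The quantity [r + 3 * W] never increases: a cancelled pair loses its
    weight, two pairs merge as in [merge_chains], and when a copy of a point of
    [xs] is cancelled with an end point of a pair, the other end point becomes
    the new copy, its displacement being charged to the weight of the pair.
    Two copies are never cancelled while pairs are left, for they are at
    distance at least [e]. *)
Lemma perturbation_step n (e r W : R) xs w x y s : 0 <= e -> 0 <= r ->
  r + 3 * W <= 1 -> 2 * (r + 3 * W) < e ^+ 4 -> well_separated e xs ->
  perturbation n.+1 xs w r W -> perm_eq w [:: x, y & s] -> closest g w x y ->
  exists n' r' W', [/\ (n' <= n)%N, 0 <= r', r' + 3 * W' <= r + 3 * W,
    g x y <= 3 * (W - W') & perturbation n' xs s r' W'].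
Proof.
move=> e0 r0 rW1 rWe sep [zs [L [zx wE zr mL [LW szL]]]] wxy cl.
have W0 : 0 <= W by rewrite -LW; exact: weight_ge0 mL.
have cW c : 0 <= c -> c <= W -> c ^+ 4 <= c.
  move=> c0 cW; rewrite exprS ler_piMr// exprn_ile1//; lra.
have g1 a b u : perm_eq w [:: a, b & u] -> g x y <= g a b by exact: cl.
(* The copy [x0] of [z.1] is cancelled with the end point [y0] of a pair, and
   [b] becomes the new copy. *)
have absorb z zs1 y0 x0 b c L1 u :
    perm_eq (map fst (z :: zs1)) xs -> z.2 = x0 ->
    (forall z', z' \in z :: zs1 -> chained g r z'.1 z'.2) ->
    partner g L y0 b c L1 -> g x0 y0 = g x y -> g x y <= g y0 b ->
    perm_eq s u -> perm_eq u (b :: (map snd zs1 ++ ends L1)) ->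
    exists n' r' W', [/\ (n' <= n)%N, 0 <= r', r' + 3 * W' <= r + 3 * W,
      g x y <= 3 * (W - W') & perturbation n' xs s r' W'].
  move=> zx2 zx0 zr1 [mL1 c0 ch WE [szE _]] g0 gl su uE.
  have W10 := weight_ge0 mL1.
  have c1 : c ^+ 4 <= c by apply: cW => //; lra.
  have G : g x y ^+ 4 <= 2 * c ^+ 4.
    apply: le_trans (scale_chained gS ch).
    by rewrite ler_pXn2r ?nnegrE ?(scale_ge0 gS).
  exists n, (r + 3 * c), (weight L1); split.
  - by [].
  - by lra.
  - by lra.
  - by have := small_edge gS c0 G; lra.
  exists ((z.1, b) :: zs1), L1; split => //.
  - exact: perm_trans su uE.
  - move=> z'; rewrite inE => /predU1P[->|z'zs].
      have -> : r + 3 * c = r + (2 * c + c) by lra.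
      apply: chained_trans (zr1 _ (mem_head _ _)) _.
      apply: chained_trans (chained_le c1 ch).
      by apply: chained_edge; rewrite zx0 g0; lra.
    by apply: chained_le (zr1 _ _); [lra|rewrite inE z'zs orbT].
  - by split => //; move: szE; rewrite szL => -[].
have P : perm_eq (map snd zs ++ ends L) [:: x, y & s].
  by rewrite perm_sym in wE; exact: perm_trans wE wxy.
have [[z [zs1 [zE zx0 P1]]]|[b [c [L1 [pL P1]]]]] := pick_endpoint gS mL P.
- have zx1 : perm_eq (map fst (z :: zs1)) xs.
    by apply: perm_trans zx; rewrite perm_sym perm_map.
  have zr1 z' : z' \in z :: zs1 -> chained g r z'.1 z'.2.
    by rewrite -(perm_mem zE); exact: zr.
  rewrite perm_sym in P1.
  have [[z' [zs2 [zE2 zy P2]]]|[b [c [L1 [pL P2]]]]] := pick_endpoint gS mL P1.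
    have zE' : perm_eq zs [:: z, z' & zs2].
      by apply: perm_trans zE _; rewrite perm_cons.
    have re : 2 * r < e ^+ 4 by lra.
    have [far1 far2] := separated_far e0 re sep zx zr zE'.
    case: L szL LW mL wE {absorb P P1 P2} => // -[[a b] c] L _ LW mL wE.
    have [/= c0 ch] := mL _ (mem_head _ _).
    have L0 := weight_ge0 (matching_behead mL).
    move: LW; rewrite weight_cons /= => LW.
    have c1 : c ^+ 4 <= c by apply: cW => //; lra.
    have : g a b < e by apply: chained_lt ch => //; lra.
    have : g x y <= g a b.
      apply: (g1 _ _ (map snd zs ++ ends L)); apply: perm_trans wE _.
      exact: perm_cat_middle2.
    by rewrite -zx0 -zy far1; lra.
  apply: (absorb z zs1 y x b c L1 _ zx1 zx0 zr1 pL _ _ (perm_refl s) P2) => //.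
  apply: (g1 _ _ (x :: (map snd zs1 ++ ends L1))).
  exact: perm_trans wxy (perm_swap2 _ _ P2).
- have [mL1 c0 ch WE [szE _]] := pL.
  have W10 := weight_ge0 mL1.
  have gxb u : perm_eq w [:: x, b & u] -> g x y ^+ 4 <= 2 * c ^+ 4.
    move=> /g1 gl; apply: le_trans (scale_chained gS ch).
    by rewrite ler_pXn2r ?nnegrE ?(scale_ge0 gS).
  have [[by_ P2]|[r1 [P3 P2]]] := perm_cons_cases P1.
    subst b; exists n, r, (weight L1); split => //; first by lra.
      by have := small_edge gS c0 (gxb _ wxy); lra.
    exists zs, L1; split => //.
    by split => //; move: szE; rewrite szL => -[].
  have [[z [zs1 [zE zy P4]]]|[b' [c' [L2 [pL2 P4]]]]] := pick_endpoint gS mL1 P2.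
    apply: (absorb z zs1 x y b c L1 _ _ zy _ pL (scale_sym gS _ _) _ P3).
    + by apply: perm_trans zx; rewrite perm_sym perm_map.
    + by move=> z'; rewrite -(perm_mem zE); exact: zr.
    + apply: (g1 _ _ (y :: r1)).
      exact: perm_trans wxy (perm_swap1 _ _ P3).
    + by rewrite perm_cons.
  have [mL2 c'0 ch' WE' [szE' _]] := pL2.
  have P5 := perm_trans P3 (perm_swap_head b P4).
  have [||v [v0 chv vle]] := merge_chains gS c0 c'0 (chained_sym gS ch) ch'.
  + rewrite [leRHS](scale_sym gS); apply: (g1 _ _ (y :: r1)).
    exact: perm_trans wxy (perm_swap1 _ _ P3).
  + apply: (g1 _ _ [:: x, b & map snd zs ++ ends L2]).
    exact: perm_trans wxy (perm_swap2 _ _ P5).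
  have g0 := scale_ge0 gS x y.
  exists n, r, (v + weight L2); split => //; [lra|lra|].
  exists zs, ((b, b', v) :: L2); split => //.
  + apply: perm_trans P3 _; rewrite perm_sym.
    apply: perm_trans (perm_cat_middle2 _ _ _ _) _.
    by rewrite perm_cons perm_sym.
  + exact: matching_cons.
  + by rewrite weight_cons; split => //=; move: szE; rewrite szL szE' => -[].
Qed.

End Reduction.

Section Transfer.
Context {R : realType} {X : choiceType} (g : X -> X -> R).
Hypothesis gS : frink_scale g.

(** The procedure sees only the distances between distinct positions. *)
Lemma greedy_isometric (zs : seq (X * X)) t :
  (forall z z' s, perm_eq zs [:: z, z' & s] -> g z.2 z'.2 = g z.1 z'.1) ->
  greedy g (map fst zs) t -> greedy g (map snd zs) t.
Proof.
suff H w u : greedy g w u -> forall zs, perm_eq w (map fst zs) ->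
    (forall z z' s, perm_eq zs [:: z, z' & s] -> g z.2 z'.2 = g z.1 z'.1) ->
    greedy g (map snd zs) u.
  by move=> iso G; exact: H G _ (perm_refl _) iso.
elim=> {w u zs t} [|w x y s t wE cl _ IH] zs wz iso.
  by move: wz => /perm_size; case: zs {iso} => //= _; exact: greedy_nil.
have [[|z [|z' zs']]// zE [xz yz' sz]] : exists2 zs', perm_eq zs zs' &
    [:: x, y & s] = map fst zs'.
  by apply: perm_map_inv; rewrite perm_sym in wz; exact: perm_trans wz wE.
rewrite xz yz' -(iso _ _ _ zE); apply: greedy_cons (perm_map snd zE) _ _.
- move=> a b r /perm_map_inv[[|z1 [|z1' r']]// zE' [-> -> _]].
  rewrite (iso _ _ _ zE) (iso _ _ _ zE') -xz -yz'.
  by apply: cl (perm_trans wz (perm_map fst zE')).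
- apply: IH => [|z1 z1' r zE']; first by rewrite sz.
  apply: (iso _ _ (z :: z' :: r)); apply: perm_trans zE _.
  apply: perm_trans (_ : perm_eq _ ([:: z; z'] ++ [:: z1, z1' & r])) _.
    by rewrite !perm_cons.
  exact: (perm_cat_middle2 [:: z; z']).
Qed.

Lemma perturbation0 (e r W : R) xs w t : 0 <= e -> 2 * r < e ^+ 4 ->
  well_separated g e xs -> perturbation g 0 xs w r W ->
  greedy g w t <-> greedy g xs t.
Proof.
move=> e0 re sep [zs [[|a L] [zx wE zr _ [_ szL]]]] //; rewrite cats0 in wE.
have iso z z' s : perm_eq zs [:: z, z' & s] -> g z.2 z'.2 = g z.1 z'.1.
  by move=> zE; have [] := separated_far gS e0 re sep zx zr zE.
split=> G.
  have := @greedy_isometric [seq (z.2, z.1) | z <- zs] t.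
  rewrite -!map_comp => /= H; apply: greedy_perm zx _; apply: H.
    move=> z z' s /perm_map_inv[[|z1 [|z1' r']]//] /iso zE.
    by move=> [-> -> _] /=.
  exact: greedy_perm wE G.
apply: (@greedy_perm _ _ _ (map snd zs)); first by rewrite perm_sym.
by apply: greedy_isometric => //; apply: greedy_perm G; rewrite perm_sym.
Qed.

Lemma perturbation_size n xs w (r W : R) : perturbation g n.+1 xs w r W ->
  (1 < size w)%N.
Proof.
move=> [zs [[|a L] [_ /perm_size szw _ _ [_ szL]]]] //.
by rewrite szw size_cat ends_cons /= !addnS.
Qed.

(** Every run on a perturbation of [xs] starts by using up the pairs and goes
    on as a run on a displaced copy of [xs]. *)
Lemma greedy_unperturb n (e r W : R) xs w t : 0 <= e -> 0 <= r ->
  r + 3 * W <= 1 -> 2 * (r + 3 * W) < e ^+ 4 -> well_separated g e xs ->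
  perturbation g n xs w r W -> greedy g w t ->
  exists2 t', t' <= t & greedy g xs t'.
Proof.
move=> e0 + + + sep; elim/ltn_ind: n r W w t => -[|n] IH r W w t r0 rW re P G.
  have W0 : 0 <= W by case: P => zs [L [_ _ _ /weight_ge0 + [<- _]]].
  have re' : 2 * r < e ^+ 4 by lra.
  by exists t => //; exact/(perturbation0 _ e0 re' sep P).
have w1 := perturbation_size P.
case: G P w1 => {w t} [//|w x y s t wE cl G] P _.
have [n' [r' [W' [nn r'0 rW' gW P']]]] :=
  perturbation_step gS e0 r0 rW re sep P wE cl.
have [//|||t' tt' G'] := IH n' _ r' W' s t r'0 _ _ P' G; [lra|lra|].
by exists t' => //; have := scale_ge0 gS x y; lra.
Qed.

(** Some run on the perturbation is obtained by closest moves as long as there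
    are pairs, followed by a copy of the given run on [xs]. *)
Lemma greedy_perturb n (e r W : R) xs w t : 0 <= e -> 0 <= r ->
  r + 3 * W <= 1 -> 2 * (r + 3 * W) < e ^+ 4 -> well_separated g e xs ->
  perturbation g n xs w r W -> greedy g xs t ->
  exists2 t', t' <= t + 3 * W & greedy g w t'.
Proof.
move=> e0 + + + sep + G; elim/ltn_ind: n r W w => -[|n] IH r W w r0 rW re P.
  have W0 : 0 <= W by case: P => zs [L [_ _ _ /weight_ge0 + [<- _]]].
  have re' : 2 * r < e ^+ 4 by lra.
  by exists t; [lra|exact/(perturbation0 _ e0 re' sep P)].
have [x [y [s [wE cl]]]] := closest_exists g (perturbation_size P).
have [n' [r' [W' [nn r'0 rW' gW P']]]] :=
  perturbation_step gS e0 r0 rW re sep P wE cl.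
have [//|||t' tt' G'] := IH n' _ r' W' s r'0 _ _ P'; [lra|lra|].
by exists (g x y + t'); [lra|exact: greedy_cons wE cl G'].
Qed.

Lemma greedy_matching s t : greedy g s t ->
  exists L, [/\ matching g L, weight L = t & perm_eq s (ends L)].
Proof.
elim=> {s t} [|w x y s t wE _ _ [L [mL Lt sL]]].
  by exists [::]; split => //; rewrite /weight big_nil.
exists ((x, y, g x y) :: L); split.
- apply: matching_cons => //; first exact: (scale_ge0 gS).
  exact: chained_edge.
- by rewrite weight_cons Lt.
- by apply: perm_trans wE _; rewrite ends_cons /= !perm_cons.
Qed.

Lemma greedy_ge (e : R) xs t :
  (forall a b s, perm_eq xs [:: a, b & s] -> e <= g a b) -> xs != [::] ->
  greedy g xs t -> e <= t.
Proof.
move=> far + G; case: G far => {xs t} [//|w x y s t wE _ G] far _.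
by have := far _ _ _ wE; have := greedy_ge0 gS G; lra.
Qed.

Definition parity (s : seq X) : X -> bool := fun x => odd (count_mem x s).

Lemma parity_cat s u : parity (s ++ u) = fun x => parity s x (+) parity u x.
Proof. by apply/funext => x; rewrite /parity count_cat oddD. Qed.

Lemma parity_perm s u : perm_eq s u -> parity s = parity u.
Proof. by move=> /permP P; apply/funext => x; rewrite /parity P. Qed.

Lemma parity_uniq s : exists2 u, uniq u & parity u = parity s.
Proof.
exists [seq x <- undup s | parity s x]; first by rewrite filter_uniq ?undup_uniq.
apply/funext => x; rewrite /parity count_uniq_mem ?filter_uniq ?undup_uniq//.
rewrite mem_filter mem_undup oddb; case: (boolP (x \in s)); rewrite ?andbT//.
by move=> /count_memPn ->; rewrite andbF.
Qed.

(** Such a sequence [z] is made of pairs of equal points, which cancel for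
    free. *)
Lemma greedy_even z s t : (forall x, ~~ parity z x) ->
  greedy g (z ++ s) t <-> greedy g s t.
Proof.
have [n] := ubnP (size z); elim: n z => // n IH [|x z]// szz ev.
have xz : x \in z.
  apply: contraT => /count_memPn c0.
  by have := ev x; rewrite /parity /= eqxx c0.
have P : perm_eq (x :: z) [:: x, x & rem x z] by rewrite perm_cons perm_to_rem.
have P' : perm_eq ((x :: z) ++ s) [:: x, x & rem x z ++ s].
  by move: P; rewrite -(perm_cat2r s).
have evr y : ~~ parity (rem x z) y.
  have := ev y; rewrite (parity_perm P) /parity /=.
  by case: (x == y); rewrite /= ?negbK.
have szr : (size (rem x z) < n)%N.
  by rewrite size_rem//; case: (z) xz szz => //= a u _; lia.
rewrite -(IH _ szr evr).
split=> G; first exact: (greedy_undouble gS (greedy_perm P' G)).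
by apply: greedy_perm (greedy_double gS x G); rewrite perm_sym.
Qed.

(** Hence the cost of exhausting a finite set modulo 2 does not depend on the
    sequence that represents it: add [z'] twice to [z], and cancel [z] against
    one of the two copies. *)
Lemma greedy_parity z z' t : parity z = parity z' ->
  greedy g z t -> greedy g z' t.
Proof.
move=> zz' G; have ev u u' : parity u = parity u' ->
    forall x, ~~ parity (u ++ u') x.
  by move=> uu' x; rewrite parity_cat uu' addbb.
apply/(greedy_even _ _ (ev _ _ zz')).
apply: (@greedy_perm _ _ _ ((z' ++ z') ++ z)).
  by apply/permP => p; rewrite !count_cat; lia.
exact/(greedy_even _ _ (ev z' z' erefl)).
Qed.

End Transfer.

(** * The Boolean group *)

(** All functions are allowed, not only the finitely supported ones: this
    keeps the group law pointwise, and the finitely supported functions form an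
    open subgroup.  The parameter [g] only selects the topology. *)
Definition boolean_group (R : realType) (X : choiceType) (g : X -> X -> R)
  : Type := X -> bool.

Section BooleanGroup.
Context {R : realType} {X : choiceType} (g : X -> X -> R).
Local Notation B := (boolean_group g).
Implicit Types (u v p q : B) (d e : R).

Definition badd u v : B := fun x => u x (+) v x.
Definition bzero : B := fun=> false.

Lemma baddA : associative badd.
Proof. by move=> u v w; apply/funext => x; exact: addbA. Qed.

Lemma badd0 : right_id bzero badd.
Proof. by move=> u; apply/funext => x; exact: addbF. Qed.

Lemma b0add : left_id bzero badd.
Proof. by move=> u; apply/funext => x; exact: addFb. Qed.

Lemma baddbb : forall u, badd u u = bzero.
Proof. by move=> u; apply/funext => x; exact: addbb. Qed.

Lemma baddC : commutative badd.
Proof. by move=> u v; apply/funext => x; exact: addbC. Qed.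

Lemma baddACA u v p q : badd (badd u v) (badd p q) = badd (badd u p) (badd v q).
Proof. by apply/funext => x; exact: addbACA. Qed.

Lemma baddK u v : badd u (badd u v) = v.
Proof. by rewrite baddA baddbb b0add. Qed.

HB.instance Definition _ := gen_eqMixin B.
HB.instance Definition _ := gen_choiceMixin B.
HB.instance Definition _ := monoid.isGroup.Build B
  baddA b0add badd0 baddbb baddbb.

(** [p] is a sum modulo 2 of pairs of total weight [t]: the Graev norm of [p]
    is at most [t]. *)
Definition pairing p t : Prop :=
  exists L, [/\ matching g L, weight L = t & parity (ends L) = p].

Lemma pairing_ge0 p t : pairing p t -> 0 <= t.
Proof. by move=> [L [mL <- _]]; exact: weight_ge0 mL. Qed.

Lemma pairing0 : pairing bzero 0.
Proof. by exists [::]; split => //; rewrite /weight big_nil. Qed.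

Lemma pairing_add p q s t : pairing p s -> pairing q t ->
  pairing (badd p q) (s + t).
Proof.
move=> [L [mL <- <-]] [L' [mL' <- <-]]; exists (L ++ L'); split.
- exact: matching_cat.
- exact: weight_cat.
- by rewrite ends_cat parity_cat.
Qed.

Definition bopen : set_system B := [set A | forall u, A u ->
  exists2 d, 0 < d & forall p t, pairing p t -> t < d -> A (badd u p)].

Let bopenT : bopen setT.
Proof. by move=> u _; exists 1. Qed.

Let bopenI : setI_closed bopen.
Proof.
move=> A C oA oC u [/oA[d d0 dA] /oC[e e0 eC]].
exists (Num.min d e); first by rewrite lt_min d0.
move=> p t pt; rewrite lt_min => /andP[td te]; split.
  exact: dA pt td.
exact: eC pt te.
Qed.

Let bopen_bigU (I : Type) (f : I -> set B) : (forall i, bopen (f i)) ->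
  bopen (\bigcup_i f i).
Proof.
move=> oF u [i _ /(oF i)[d d0 dF]].
by exists d => // p t pt td; exists i => //; exact: dF pt td.
Qed.

HB.instance Definition _ := isOpenTopological.Build B bopenT bopenI bopen_bigU.

Lemma bopenE (A : set B) : open A = bopen A.
Proof. by []. Qed.

Lemma bopen_ball u d : open [set v | exists2 t, pairing (badd u v) t & t < d].
Proof.
rewrite bopenE => v [t pt td]; exists (d - t); first by rewrite subr_gt0.
move=> p t' pt' t'd; exists (t + t'); last by lra.
by rewrite baddA; exact: pairing_add.
Qed.

Lemma bnbhsP u (A : set B) : nbhs u A <->
  exists2 d, 0 < d & forall p t, pairing p t -> t < d -> A (badd u p).
Proof.
split=> [|[d d0 dA]].
  rewrite nbhsE => -[U [oU Uu] UA]; rewrite bopenE in oU.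
  have [d d0 dU] := oU u Uu.
  by exists d => // p t pt td; exact/UA/(dU _ _ pt td).
rewrite nbhsE; exists [set v | exists2 t, pairing (badd u v) t & t < d].
  split; first exact: bopen_ball.
  by exists 0 => //; rewrite baddbb; exact: pairing0.
by move=> v [t pt td]; rewrite -(baddK u v); exact: dA pt td.
Qed.

Let bmul_continuous : continuous (fun uv : B * B => (uv.1 * uv.2)%g).
Proof.
move=> [u v] A /bnbhsP[d d0 dA].
have d20 : 0 < d / 2 by lra.
exists ([set u' | exists2 t, pairing (badd u u') t & t < d / 2],
        [set v' | exists2 t, pairing (badd v v') t & t < d / 2]).
  by split; apply: open_nbhs_nbhs; split => /=; try exact: bopen_ball;
    exists 0 => //; rewrite baddbb; exact: pairing0.
move=> [u' v'] /= [[s us sd] [t vt td]].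
have := pairing_add us vt; rewrite baddACA => pt.
by have := dA _ _ pt; rewrite baddK; apply; lra.
Qed.

Let binv_continuous : continuous (fun u : B => (u^-1)%g).
Proof. by move=> u; exact: cvg_id. Qed.

HB.instance Definition _ := isTopologicalGroup.Build B
  bmul_continuous binv_continuous.

Lemma bopen_translate u (A : set B) : open A -> open [set v | A (badd u v)].
Proof.
rewrite !bopenE => oA v /oA[d d0 dA]; exists d => // p t pt td.
by rewrite /= baddA; exact: dA pt td.
Qed.

Lemma bclopen_translate u (A : set B) : clopen A ->
  clopen [set v | A (badd u v)].
Proof.
move=> [oA cA]; split; first exact: bopen_translate.
rewrite -openC; apply: (@bopen_translate u (~` A)).
by rewrite openC.
Qed.

End BooleanGroup.

(** * Clopen neighborhoods and metrizability *)

Section ClopenBase.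
Context {R : realType} {X : choiceType} (g : X -> X -> R).
Hypothesis gS : frink_scale g.
Hypothesis g_loc : forall x y, x <> y -> exists2 e : R, 0 < e &
  forall x' y', g x x' < e -> g y y' < e -> g x' y' = g x y.
Local Notation B := (boolean_group g).
Implicit Types (u v p q : B) (d e : R).

Lemma common_radius (T : eqType) (s : seq T) (P : R -> T -> Prop) :
  (forall z d e, d <= e -> P e z -> P d z) ->
  (forall z, exists2 e, 0 < e & P e z) ->
  exists2 e, 0 < e & forall z, z \in s -> P e z.
Proof.
move=> Ple ex; elim: s => [|z s [e e0 es]]; first by exists 1.
have [d d0 dz] := ex z; exists (Num.min d e); first by rewrite lt_min d0.
by move=> z'; rewrite inE => /predU1P[->|/es ez]; [apply: Ple dz|apply: Ple ez];
  rewrite ge_min lexx ?orbT.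
Qed.

(** Finitely many pairs of distinct points are involved, and [g] is locally
    constant near each of them. *)
Lemma uniq_well_separated (xs : seq X) : uniq xs ->
  exists2 e, 0 < e & well_separated g e xs.
Proof.
move=> uxs; pose P e (z : X * X) := z.1 <> z.2 -> forall a b,
  g z.1 a < e -> g z.2 b < e -> g a b = g z.1 z.2 /\ e <= g z.1 z.2.
have [z d e de Pe|[x y]|e e0 eP] :=
    @common_radius _ [seq (a, b) | a <- xs, b <- xs] P.
- move=> zz a b ga gb.
  have [-> ez] := Pe zz a b (lt_le_trans ga de) (lt_le_trans gb de).
  by split => //; exact: le_trans de ez.
- have [->|/eqP xy] := eqVneq x y; first by exists 1 => // -[].
  have [e e0 eP] := g_loc xy.
  have gxy : 0 < g x y.
    by rewrite lt0r (scale_ge0 gS) andbT; apply/eqP => /(scale_eq0 gS).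
  exists (Num.min e (g x y)); first by rewrite lt_min e0.
  move=> _ a b; rewrite !lt_min => /andP[ga _] /andP[gb _] /=.
  by rewrite (eP _ _ ga gb) ge_min lexx orbT.
exists e => // a b s abs; apply: (eP (a, b)).
  by apply/allpairsP; exists (a, b); rewrite !(perm_mem abs) !inE !eqxx orbT.
by move=> /= ab; move: uxs; rewrite (perm_uniq abs) /= inE ab eqxx.
Qed.

Lemma perturbation_ends (xs : seq X) L : matching g L ->
  perturbation g (size L) xs (xs ++ ends L) 0 (weight L).
Proof.
move=> mL; exists [seq (x, x) | x <- xs], L; split => //.
- by rewrite -map_comp map_id.
- by rewrite -map_comp map_id.
- by move=> z /mapP[x _ ->]; exact: chained_refl.
Qed.

(** The case [r = 0] of the perturbation lemmas. *)
Lemma greedy_robust (xs : seq X) : uniq xs -> exists2 d, 0 < d &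
  forall L, matching g L -> weight L < d ->
    (forall t, greedy g xs t ->
      exists2 t', t' <= t + 3 * weight L & greedy g (xs ++ ends L) t') /\
    (forall t, greedy g (xs ++ ends L) t ->
      exists2 t', t' <= t & greedy g xs t').
Proof.
move=> /uniq_well_separated[e e0 sep].
have e4 : 0 < e ^+ 4 by exact: exprn_gt0.
exists (Num.min (1 / 3) (e ^+ 4 / 6)); first by rewrite lt_min; lra.
move=> L mL; rewrite lt_min => /andP[L1 L2].
have H1 : 0 + 3 * weight L <= 1 by lra.
have H2 : 2 * (0 + 3 * weight L) < e ^+ 4 by lra.
by split=> t; [apply: (greedy_perturb gS (ltW e0) _ H1 H2 sep)|
  apply: (greedy_unperturb gS (ltW e0) _ H1 H2 sep)] => //;
  exact: perturbation_ends.
Qed.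

(** These sets form a clopen base at 0. *)
Definition greedy_ball d : set B := [set p | exists s t,
  [/\ greedy g s t, t < d & parity s = p]].

(** The pairs cancelled by a run, weighted by their distances. *)
Lemma greedy_ball_pairing d p : greedy_ball d p ->
  exists2 t, pairing p t & t < d.
Proof.
move=> [s [t [/(greedy_matching gS)[L [mL Lt sL]] td <-]]].
by exists t => //; exists L; split => //; rewrite (parity_perm sL).
Qed.

Lemma greedy_ball0 d : 0 < d -> greedy_ball d (bzero g).
Proof. by move=> d0; exists [::], 0; split => //; exact: greedy_nil. Qed.

(** A sum of pairs is a perturbation of the empty set. *)
Lemma pairing_greedy_ball d p t : d <= 1 -> pairing p t -> 3 * t < d ->
  greedy_ball d p.
Proof.
move=> d1 [L [mL <- <-]] Ld.
(* Any e would do for the empty set; e = 2 makes e ^ 4 large enough. *)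
have sep : well_separated g 2 [::] by move=> a b s /perm_size.
have H1 : 0 + 3 * weight L <= 1 by lra.
have H2 : 2 * (0 + 3 * weight L) < 2 ^+ 4 :> R by rewrite -natrX; lra.
have [//|//|t' t'le G] := greedy_perturb gS _ _ H1 H2 sep
  (perturbation_ends [::] mL) (greedy_nil g).
by exists (ends L), t'; split => //; lra.
Qed.

Lemma greedy_ball_open d : open (greedy_ball d).
Proof.
rewrite bopenE => u [s [t [Gs td <-]]].
have [xs uxs xsE] := parity_uniq s.
have G := greedy_parity gS (esym xsE) Gs.
have [e e0 eP] := greedy_robust uxs.
exists (Num.min e ((d - t) / 3)); first by rewrite lt_min; lra.
move=> _ _ [L [mL <- <-]]; rewrite lt_min => /andP[Le Ld].
have [/(_ _ G)[t' t'le G'] _] := eP _ mL Le.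
exists (xs ++ ends L), t'; split => //; first by lra.
by rewrite parity_cat xsE.
Qed.

(** A finite set that cannot be exhausted at a cost less than d cannot be so
    after a small perturbation either, by [greedy_unperturb]; the functions with
    infinite support are kept away by the subgroup of finite ones. *)
Lemma greedy_ball_clopen d : clopen (greedy_ball d).
Proof.
split; first exact: greedy_ball_open.
rewrite -openC bopenE => u /= uO.
have [[s su]|nu] := pselect (exists s, parity s = u); last first.
  exists 1 => // p t [L [_ _ Lp]] _ [s [_ [_ _ sE]]]; apply: nu.
  exists (ends L ++ s); rewrite parity_cat sE Lp.
  by rewrite -[LHS]/(badd p (badd u p)) (baddC u) baddK.
have [xs uxs xsE] := parity_uniq s.
have [e e0 eP] := greedy_robust uxs.
exists e => // _ _ [L [mL <- <-]] Le [s' [t [G td sE]]]; apply: uO.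
have [_ H] := eP _ mL Le.
have [|t' t't G'] := H t.
  by apply: (greedy_parity gS _ G); rewrite sE parity_cat xsE su.
by exists xs, t'; split => //; [exact: le_lt_trans td|rewrite xsE].
Qed.

Lemma boolean_ind_zero : ind_zero B.
Proof.
split; first by exists (bzero g).
exists [set U | exists u d, 0 < d /\ U = [set v | greedy_ball d (badd u v)]].
  split=> [_ [u [d [_ ->]]]|u A].
    by apply: bopen_translate; exact: greedy_ball_open.
  move=> /bnbhsP[d d0 dA].
  exists [set v | greedy_ball d (badd u v)].
    split; first by exists u, d.
    by rewrite /= baddbb; exact: greedy_ball0.
  move=> v /greedy_ball_pairing[t pt td] /=; rewrite -(baddK u v).
  exact: dA pt td.
move=> _ [u [d [_ ->]]]; apply: bclopen_translate; exact: greedy_ball_clopen.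
Qed.

(** If [p] is nonempty, the first move of any run exhausting it costs at least
    the least distance between its points. *)
Lemma pairing_small_eq0 p :
  (forall d, 0 < d -> exists2 t, pairing p t & t < d) -> p = bzero g.
Proof.
move=> small.
have sm d : 0 < d -> d <= 1 -> greedy_ball d p.
  move=> d0 d1; have [|t pt td] := small (d / 3); first by lra.
  by apply: (pairing_greedy_ball d1 pt); lra.
have [s [t [_ _ sp]]] := sm 1 ltr01 (lexx _).
have [xs uxs xsE] := parity_uniq s.
have [xs0|xsN] := eqVneq xs [::].
  by rewrite -sp -xsE xs0; apply/funext.
have [e e0 sep] := uniq_well_separated uxs.
have d0 : 0 < Num.min e 1 by rewrite lt_min e0 ltr01.
have [|s' [t' [G' t'd s'E]]] := sm _ d0; first by rewrite ge_min lexx orbT.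
have G : greedy g xs t' by apply: (greedy_parity gS _ G'); rewrite s'E xsE.
have : e <= t'.
  apply: (greedy_ge gS _ xsN G) => a b r abr.
  by have [] := sep _ _ _ abr a b; rewrite ?(gxx gS).
by move: t'd; rewrite lt_min leNgt => /andP[-> _].
Qed.

(** Truncated at 1, so that it makes sense for functions that are not a sum
    of pairs. *)
Definition pairing_norm p : R := inf [set t | t = 1 \/ pairing p t].

Let E p : set R := [set t | t = 1 \/ pairing p t].

Let E_lb p : lbound (E p) 0.
Proof. by move=> t [->//|/pairing_ge0]; exact. Qed.

Lemma pairing_norm_le p t : t = 1 \/ pairing p t -> pairing_norm p <= t.
Proof. by move=> pt; apply: ge_inf => //; exists 0; exact: E_lb. Qed.

Lemma pairing_norm_ge0 p : 0 <= pairing_norm p.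
Proof. by apply: lb_le_inf; [exists 1; left|exact: E_lb]. Qed.

Lemma pairing_norm_lt p e : pairing_norm p < e ->
  exists2 t, t = 1 \/ pairing p t & t < e.
Proof.
move=> pe; have [||t Et te] := @inf_adherent _ (E p) (e - pairing_norm p).
- by rewrite subr_gt0.
- by split; [exists 1; left|exists 0; exact: E_lb].
- by exists t => //; move: te; rewrite -/(pairing_norm p); lra.
Qed.

Lemma boolean_metric :
  is_metric (fun u v : B => pairing_norm (badd u v)).
Proof.
split.
- by move=> u v; exact: pairing_norm_ge0.
- move=> u v; split=> [uv0|->]; last first.
    apply/le_anti; rewrite pairing_norm_ge0 andbT baddbb.
    by apply: pairing_norm_le; right; exact: pairing0.
  suff uv : badd u v = bzero g by rewrite -(baddK u v) uv badd0.
  apply: pairing_small_eq0 => d d0.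
  have [|t [t1|pt]] := @pairing_norm_lt (badd u v) (Num.min d 1).
  + by rewrite uv0 lt_min d0 ltr01.
  + by rewrite t1 lt_min ltxx andbF.
  + by rewrite lt_min => /andP[td _]; exists t.
- by move=> u v; rewrite baddC.
- move=> u v w; apply/ler_addgt0Pl => e e0.
  have [|s sP se] :=
    @pairing_norm_lt (badd u v) (pairing_norm (badd u v) + e / 2).
    by lra.
  have [|t tP te] :=
    @pairing_norm_lt (badd v w) (pairing_norm (badd v w) + e / 2).
    by lra.
  suff : pairing_norm (badd u w) <= s + t by lra.
  have s0 : 0 <= s by case: sP => [->//|/pairing_ge0].
  have t0 : 0 <= t by case: tP => [->//|/pairing_ge0].
  have n1 : pairing_norm (badd u w) <= 1 by apply: pairing_norm_le; left.
  case: sP => [->|ps]; first by lra.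
  case: tP => [->|pt]; first by lra.
  apply: pairing_norm_le; right.
  have <- : badd (badd u v) (badd v w) = badd u w by rewrite -baddA baddK.
  exact: pairing_add.
Qed.

Lemma boolean_metrizable : metrizable R B.
Proof.
exists (fun u v : B => pairing_norm (badd u v)); first exact: boolean_metric.
move=> A; rewrite bopenE; split=> oA u /oA[d d0 dA].
  exists (Num.min d 1); first by rewrite lt_min d0 ltr01.
  move=> v /pairing_norm_lt[t []]; first by move=> ->; rewrite lt_min ltxx andbF.
  by move=> pt; rewrite lt_min -[X in A X](baddK u v) => /andP[td _]; exact: dA pt td.
exists d => // p t pt td; apply: dA; rewrite /= baddK.
by apply: le_lt_trans td; apply: pairing_norm_le; right.
Qed.

End ClopenBase.

Section Embedding.
Context {R : realType} {X : topologicalType} (g : X -> X -> R).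
Hypothesis gS : frink_scale g.
Hypothesis g_loc : forall x y, x <> y -> exists2 e : R, 0 < e &
  forall x' y', g x x' < e -> g y y' < e -> g x' y' = g x y.
Hypothesis g_top : forall A : set X, open A <-> forall x, A x ->
  exists2 e : R, 0 < e & [set y | g x y < e] `<=` A.

(** The greedy procedure exhausts {x, y} at the cost [g x y] exactly, so greedy
    balls around x trace balls of [g]. *)
Lemma parity_embedding :
  topological_embedding (fun x : X => parity [:: x] : boolean_group g).
Proof.
split=> [x y /(congr1 (@^~ x))|A].
  by rewrite /parity /= eqxx !addn0; case: eqVneq.
have pairE x y : badd (parity [:: x] : boolean_group g) (parity [:: y]) =
    parity [:: x; y].
  by rewrite (parity_cat [:: x] [:: y]).
split=> [/g_top oA|[U oU ->]].
  exists (\bigcup_(U in [set U : set (boolean_group g) | open U /\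
      (fun x => parity [:: x] : boolean_group g) @^-1` U `<=` A]) U).
    by apply: bigcup_open => U [].
  apply/seteqP; split=> [x /oA[e e0 eA]|x [U [_ UA] Ux]]; last exact: UA.
  exists [set v | greedy_ball e (badd (parity [:: x]) v)].
    split; first by apply: bopen_translate; exact: greedy_ball_open.
    move=> y /= [s [t [G te sE]]]; apply: eA => /=.
    have {}G : greedy g [:: x; y] t.
      by apply: (greedy_parity gS _ G); rewrite sE.
    apply: le_lt_trans te; apply: (greedy_ge gS _ _ G) => // a b s'.
    case/perm_cons_cases => [[<-]|[r []]].
      by rewrite perm_sym => /perm_small_eq -/(_ isT)[-> _].
    rewrite perm_sym => /perm_small_eq -/(_ isT)[-> ->].
    by move=> /perm_small_eq -/(_ isT)[-> _]; rewrite (scale_sym gS).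
  by rewrite /= baddbb; exact: greedy_ball0.
apply/g_top => x /= Ux; rewrite bopenE in oU; have [d d0 dU] := oU _ Ux.
exists d => // y /= gxy.
rewrite -[parity [:: y]](@baddK _ _ g (parity [:: x])).
apply: (dU _ (g x y)) gxy; exists [:: (x, y, g x y)]; split.
- apply: matching_cons => //; first exact: (scale_ge0 gS).
  exact: chained_edge.
- by rewrite weight_cons /weight big_nil addr0.
- by rewrite pairE.
Qed.

End Embedding.

(** * A scale adapted to a sequence of clopen entourages *)

Section ScaleOfUniformity.
Context {R : realType} {X : topologicalType} (V : nat -> set (X * X)).
Hypothesis V0 : V 0%N = setT.
Hypothesis V_refl : forall n x, V n (x, x).
Hypothesis V_sym : forall n x y, V n (x, y) -> V n (y, x).
Hypothesis V_comp : forall n x y z w,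
  V n.+1 (x, y) -> V n.+1 (y, z) -> V n.+1 (z, w) -> V n (x, w).
Hypothesis V_sep : forall x y, (forall n, V n (x, y)) -> x = y.
Hypothesis V_clopen : forall n, clopen (V n).
Hypothesis V_top : forall A : set X, open A <->
  forall x, A x -> exists n, forall y, V n (x, y) -> A y.

(* Any positive number below 1 with 2 * th ^ 4 >= 1 gives Frink's inequality. *)
Let th : R := 6 / 7.

Let th_gt0 n : 0 < th ^+ n.
Proof. by rewrite exprn_gt0// /th; lra. Qed.

Let th_le m n : (m <= n)%N -> th ^+ n <= th ^+ m.
Proof. by move=> mn; apply: ler_wiXn2l => //; rewrite /th; lra. Qed.

Let th_small (e : R) : 0 < e -> exists n, th ^+ n < e.
Proof.
move=> e0; have th1 : `|th| < 1 by rewrite ger0_norm /th; lra.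
have /cvgrPdist_lt/(_ _ e0)[n _ nP] := cvg_expr th1.
exists n; have := nP n (leqnn n); rewrite /= sub0r normrN ger0_norm//.
exact: ltW.
Qed.

Let V_anti m n z : (m <= n)%N -> V n z -> V m z.
Proof.
case: z => x y; elim: n m => [|n IH] m; first by rewrite leqn0 => /eqP ->.
rewrite leq_eqVlt => /predU1P[->//|mn] Vn; apply: IH => //.
exact: V_comp (V_refl _ _) Vn (V_refl _ _).
Qed.

(** [th ^+ k] for the last k with (x, y) in [V k], and 0 if there is no last
    one. *)
Definition uniform_scale (x y : X) : R :=
  if pselect (exists n, ~~ `[< V n.+1 (x, y) >]) is left ex
  then th ^+ ex_minn ex else 0.

Let g := uniform_scale.

Lemma uniform_scaleP x y :
  ((forall n, V n (x, y)) /\ g x y = 0) \/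
  (exists k, [/\ V k (x, y), ~ V k.+1 (x, y) & g x y = th ^+ k]).
Proof.
rewrite /g /uniform_scale; case: pselect => [ex|nex].
  right; case: ex_minnP => k /asboolPn nVk kmin; exists k; split => //.
  case: k nVk kmin => [|k] _ kmin; first by rewrite V0.
  by apply: contrapT => /asboolPn /kmin; rewrite ltnn.
left; split=> // -[|n]; first by rewrite V0.
by apply: contrapT => /asboolPn nV; apply: nex; exists n.
Qed.

Lemma uniform_scale_lt n x y : g x y < th ^+ n <-> V n.+1 (x, y).
Proof.
have [[VV ->]|[k [Vk nVk ->]]] := uniform_scaleP x y; first by split.
split=> [kn|Vn].
  apply: (V_anti _ Vk); rewrite ltnNge; apply/negP => /th_le.
  by rewrite leNgt kn.
have nk : (n < k)%N.
  by rewrite ltnNge; apply/negP => kn; apply: nVk; apply: V_anti Vn.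
rewrite lt_neqAle th_le ?(ltnW nk)// andbT.
have : th ^+ k <= th ^+ n.+1 by exact: th_le.
by apply: contraTneq => ->; rewrite -ltNge exprS gtr_pMl// /th; lra.
Qed.

Lemma uniform_scale_eq k x y : V k (x, y) -> ~ V k.+1 (x, y) ->
  g x y = th ^+ k.
Proof.
move=> Vk nVk; have [[/(_ k.+1)//]|[j [Vj nVj ->]]] := uniform_scaleP x y.
congr (_ ^+ _); apply/eqP; rewrite eqn_leq; apply/andP; split.
  by rewrite leqNgt; apply/negP => kj; apply: nVk; apply: V_anti Vj.
by rewrite leqNgt; apply/negP => jk; apply: nVj; apply: V_anti Vk.
Qed.

Lemma uniform_frink_scale : frink_scale g.
Proof.
have g0 x y : 0 <= g x y.
  have [[_ ->]//|[k [_ _ ->]]] := uniform_scaleP x y; exact: ltW.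
split=> //.
- move=> x y; split=> [gxy|<-].
    have [[/V_sep//]|[k [_ _]]] := uniform_scaleP x y.
    by rewrite gxy => /eqP; rewrite eq_sym gt_eqF.
  by have [[]//|[k [_ /(_ (V_refl _ _))]]] := uniform_scaleP x x.
- move=> x y; have [[Vxy ->]|[k [Vk nVk ->]]] := uniform_scaleP x y.
    by have [[_ ->]//|[k [_ nVk _]]] := uniform_scaleP y x; case: nVk; exact/V_sym.
  by apply/esym/uniform_scale_eq => [|/V_sym//]; exact/V_sym.
- move=> M a b c d gab gbc gcd.
  have M0 : 0 <= M by apply: le_trans gab; rewrite exprn_ge0.
  have [[_ ->]|[k [_ nVk ->]]] := uniform_scaleP a d.
    by rewrite expr0n mulr_ge0.
  rewrite leNgt; apply/negP => Mk; apply: nVk.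
  have small x y : g x y ^+ 4 <= M -> V k.+2 (x, y).
    move=> gM; apply/uniform_scale_lt.
    rewrite -(@ltr_pXn2r _ 4) ?nnegrE ?g0 ?(ltW (th_gt0 _))//.
    apply: le_lt_trans gM _; rewrite [th ^+ k.+1]exprS exprMn.
    have : 0 < (th ^+ k) ^+ 4 by rewrite exprn_gt0.
    have -> : th ^+ 4 = 1296 / 2401 by rewrite /th; field.
    by lra.
  exact: V_comp (small _ _ gab) (small _ _ gbc) (small _ _ gcd).
Qed.

Lemma uniform_scale_top (A : set X) : open A <-> forall x, A x ->
  exists2 e : R, 0 < e & [set y | g x y < e] `<=` A.
Proof.
rewrite V_top; split=> oA x /oA.
  move=> [n nA]; exists (th ^+ n) => // y /uniform_scale_lt Vn.
  by apply: nA; exact: V_anti Vn.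
move=> [e e0 eA]; have [n ne] := th_small e0.
exists n.+1 => y /uniform_scale_lt gn; apply: eA; exact: lt_trans ne.
Qed.

(** Near (x, y) the last index k with (x, y) in [V k] does not change, because
    the difference of [V k] and [V k.+1] is open. *)
Lemma uniform_scale_loc x y : x <> y -> exists2 e : R, 0 < e &
  forall x' y', g x x' < e -> g y y' < e -> g x' y' = g x y.
Proof.
move=> xy; have [[/V_sep//]|[k [Vk nVk gk]]] := uniform_scaleP x y.
have : nbhs (x, y) (V k `&` ~` V k.+1).
  apply: open_nbhs_nbhs; split => //; apply: openI; first by case: (V_clopen k).
  by rewrite openC; case: (V_clopen k.+1).
move=> [[A B] /= [nA nB] AB].
have rad z C : nbhs z C -> exists2 e : R, 0 < e & [set z' | g z z' < e] `<=` C.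
  rewrite nbhsE => -[C' [/uniform_scale_top oC' C'z] CC'].
  have [e e0 eC] := oC' _ C'z; exists e => //; exact: subset_trans CC'.
have [e e0 eA] := rad _ _ nA; have [d d0 dB] := rad _ _ nB.
exists (Num.min e d); first by rewrite lt_min e0.
move=> x' y'; rewrite !lt_min => /andP[xe _] /andP[_ yd].
have [Vk' nVk'] : (V k `&` ~` V k.+1) (x', y').
  by apply: AB; split; [exact: eA|exact: dB].
by rewrite gk; exact: uniform_scale_eq.
Qed.

End ScaleOfUniformity.

Section ClopenSequence.
Local Open Scope relation_scope.
Context {X : topologicalType} (U B : set_system (X * X)).
Hypothesis Uu : is_uniformity U.
Hypothesis B_countable : countable B.
Hypothesis B_base : uniformity_base U B.

Let base_split V : U V -> exists2 W, B W & W \; W \; W `<=` V.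
Proof.
move=> UV; have [W1 UW1 W1V] := uniformity_split Uu UV.
have [W2 UW2 W2W1] := uniformity_split Uu UW1.
have [W BW WW2] := B_base.2 _ UW2; exists W => //.
have [dW _] := uniformity_entourage Uu UW2.
move=> [x w] /= [z [y xy yz] zw]; apply: W1V; exists z.
  by apply: W2W1; exists y; exact: WW2.
by apply: W2W1; exists w; [exact: WW2|exact: dW].
Qed.

(** A base element that splits twice inside [V n] and lies in the n-th member
    of an enumeration of the base. *)
Lemma base_sequence : exists V : nat -> set (X * X),
  [/\ V 0%N = setT, forall n, U (V n), forall n, V n = setT \/ B (V n),
      forall n, V n.+1 \; V n.+1 \; V n.+1 `<=` V n &
      forall W, U W -> exists n, V n `<=` W].
Proof.
have [Bne UB] : B !=set0 /\ B `<=` U.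
  have [BU bB] := B_base; split => //.
  by have [W /bB[W' BW' _]] := uniformity_nonempty Uu; exists W'.
have [f finj] := countable_injP _ B_countable.
pose W n := xget setT [set b | B b /\ f b = n].
have UT : U setT.
  have [W0 UW0] := uniformity_nonempty Uu.
  by apply: (uniformity_up Uu UW0).
have UW n : U (W n).
  rewrite /W; case: xgetP => [b _ [Bb _]|_]; [exact: UB|exact: UT].
pose next n V := xget setT [set b | [/\ B b, b `<=` W n & b \; b \; b `<=` V]].
pose V := fix V n := if n is n'.+1 then next n' (V n') else setT.
have nextP n S : U S -> [/\ B (next n S), next n S `<=` W n &
    next n S \; next n S \; next n S `<=` S].
  move=> US; have [b Bb bS] := base_split (uniformity_setI Uu US (UW n)).
  have [db _] := uniformity_entourage Uu (UB _ Bb).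
  have bSW : b \; b \; b `<=` S by move=> xy /bS[].
  have bW : b `<=` W n.
    move=> [x y] bxy.
    suff bbb : (b \; b \; b) (x, y) by have [] := bS _ bbb.
    by exists x => //; exists x; exact: db.
  have [] : [set b | [/\ B b, b `<=` W n & b \; b \; b `<=` S]] (next n S).
    by apply: (@xgetI _ _ _ b); split.
  by split.
have UV n : U (V n) by elim: n => [|n /(nextP n)[/UB]].
exists V; split => //.
- by case=> [|n]; [left|right; have [] := nextP n _ (UV n)].
- by move=> n; have [] := nextP n _ (UV n).
- move=> S /(B_base.2)[b Bb bS]; exists (f b).+1.
  have [_ + _] := nextP (f b) _ (UV (f b)).
  move=> /subset_trans; apply; apply: subset_trans bS.
  rewrite /W; case: xgetP => [c _ [Bc fc]|/(_ b)[]//].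
  by rewrite (finj c b)//; rewrite inE.
Qed.

End ClopenSequence.

(** * The uniformity induced by a group *)

Section GroupToUniformity.
Context {R : realType} {X : topologicalType} {G : topologicalGroupType}.
Context (f : X -> G).
Hypothesis f_emb : topological_embedding f.
Context (d : G -> G -> R).
Hypothesis d_metric : is_metric d.
Hypothesis d_open : forall A : set G, open A <->
  forall x, A x -> exists2 e : R, 0 < e & [set y | d x y < e] `<=` A.
Local Open Scope group_scope.

Let ball (e : R) : set G := [set z | (d 1%g z < e)%R].

Lemma metric_ball_nbhs (e : R) : (0 < e)%R -> nbhs 1 (ball e).
Proof.
have [d0 deq dsym dtri] := d_metric.
move=> e0; apply: open_nbhs_nbhs; split; last first.
  by rewrite /ball /= (deq 1 1).2.
apply/d_open => z ze; exists (e - d 1%g z)%R; first by rewrite subr_gt0.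
move=> y /= zy; apply: le_lt_trans (dtri 1%g z y) _.
by rewrite addrC -ltrBrDr.
Qed.

Lemma nbhs_metric_ball (N : set G) : nbhs 1 N ->
  exists2 e : R, (0 < e)%R & ball e `<=` N.
Proof.
rewrite nbhsE => -[D [/d_open oD /oD[e e0 eD]] DN].
by exists e => //; exact: subset_trans DN.
Qed.

Lemma embedding_continuous : continuous f.
Proof.
by apply/continuousP => A oA; apply/(f_emb.2 (f @^-1` A)); exists A.
Qed.

Definition left_quotient (xy : X * X) : G := (f xy.1)^-1 * f xy.2.

Lemma left_quotient_continuous : continuous left_quotient.
Proof.
move=> xy; apply: (@continuous_comp _ _ _
  (fun xy : X * X => ((f xy.1)^-1, f xy.2)) (fun uv : G * G => uv.1 * uv.2));
  last exact: mulg_continuous.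
apply: cvg_pair => /=.
  apply: (@continuous_comp _ _ _ (fun xy : X * X => f xy.1) (fun u : G => u^-1));
    last exact: invg_continuous.
  apply: (@continuous_comp _ _ _ fst f); first exact: cvg_fst.
  exact: embedding_continuous.
apply: (@continuous_comp _ _ _ snd f); first exact: cvg_snd.
exact: embedding_continuous.
Qed.

(** Both quotients are required, as entourages have to be symmetric. *)
Definition left_entourage (N : set G) : set (X * X) :=
  [set xy | N (left_quotient xy) /\ N (left_quotient (xy.2, xy.1))].

Lemma left_entourage_entourage (N : set G) : nbhs 1 N ->
  is_entourage (left_entourage N).
Proof.
move=> /nbhs_singleton N1; split.
  by move=> [x y] /= xy; rewrite -[y]xy /left_entourage /left_quotient /= mulVg.
by apply/seteqP; split=> -[x y] [].
Qed.

Lemma left_entourage_sub (N M : set G) : N `<=` M ->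
  left_entourage N `<=` left_entourage M.
Proof. by move=> NM xy [/NM ? /NM]. Qed.

Lemma left_entourage_clopen (N : set G) : clopen N ->
  clopen (left_entourage N).
Proof.
move=> cN; apply: clopenI; first exact: preimage_clopen left_quotient_continuous.
apply: (@preimage_clopen _ _ (left_quotient \o (fun xy => (xy.2, xy.1)))) => //.
move=> xy; apply: continuous_comp; first exact: swap_continuous.
exact: left_quotient_continuous.
Qed.

Definition left_uniformity : set_system (X * X) :=
  [set W | is_entourage W /\ exists2 N, nbhs 1 N & left_entourage N `<=` W].

Lemma left_entourageE (N : set G) : nbhs 1 N ->
  left_uniformity (left_entourage N).
Proof. by move=> N1; split; [exact: left_entourage_entourage|exists N]. Qed.

Lemma left_quotientM x y z :
  left_quotient (x, y) * left_quotient (y, z) = left_quotient (x, z).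
Proof. by rewrite /left_quotient /= mulgA mulgK. Qed.

Lemma left_uniformity_uniformity : is_uniformity left_uniformity.
Proof.
split.
- by exists (left_entourage setT); apply: left_entourageE; exact: filterT.
- by move=> W [].
- move=> V W [_ [N N1 NV]] eW VW; split => //; exists N => //.
  exact: subset_trans VW.
- move=> V W [[dV sV] [N N1 NV]] [[dW sW] [M M1 MW]]; split.
    split; first by move=> xy dxy; split; [exact: dV|exact: dW].
    by rewrite -{2}sV -{2}sW.
  exists (N `&` M); first exact: filterI.
  by move=> xy [[Nxy Mxy] [Nyx Myx]]; split; [exact: NV|exact: MW].
- move=> V [_ [N N1 NV]].
  have : nbhs ((1 : G) * 1) N by rewrite mulg1.
  move=> /(@mulg_continuous G (1, 1))[[A B] /= [A1 B1] AB].
  exists (left_entourage (A `&` B)).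
    by apply: left_entourageE; exact: filterI.
  move=> [x z] /= [y [[Axy _] [_ Byx]] [[_ Byz] [Azy _]]].
  apply: NV; split; rewrite /= -(left_quotientM _ y).
    exact: (AB (_, _)).
  exact: (AB (_, _)).
- have [d0 deq dsym dtri] := d_metric.
  apply/seteqP; split=> [[x y] /= Uxy|xy dxy V [[dV _] _]]; last exact: dV.
  have [//|/eqP xy] := eqVneq x y.
  have q1 : (0 < d 1%g (left_quotient (x, y)))%R.
    rewrite lt0r d0 andbT; apply/eqP => /deq q1; apply: xy; apply: f_emb.1.
    by apply: (mulgI (f x)^-1); rewrite mulVg.
  have [/=] := Uxy _ (left_entourageE (metric_ball_nbhs q1)).
  by rewrite /ball /= ltxx.
Qed.

Lemma left_uniformity_generates : generates_topology left_uniformity.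
Proof.
move=> A; split=> [/(f_emb.2 A)[D oD ->] x Dx|UA].
  have : nbhs (f x * 1) D by rewrite mulg1; exact: open_nbhs_nbhs.
  move=> /(@mulg_continuous G (f x, 1))[[P N] /= [Px N1] PN].
  exists (left_entourage N); first exact: left_entourageE.
  move=> y /xsectionP[/= Nxy _].
  have := PN (f x, left_quotient (x, y)); rewrite /left_quotient /= mulVKg.
  by apply; split => //; exact: nbhs_singleton Px.
rewrite openE => x /UA[W [_ [N N1 NW]] WA].
have pc : {for x, continuous (fun y => left_quotient (x, y))}.
  apply: continuous_comp; last exact: left_quotient_continuous.
  by apply: cvg_pair; [exact: cvg_cst|exact: cvg_id].
have qc : {for x, continuous (fun y => left_quotient (y, x))}.
  apply: continuous_comp; last exact: left_quotient_continuous.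
  by apply: cvg_pair; [exact: cvg_id|exact: cvg_cst].
have xx : left_quotient (x, x) = 1 by rewrite /left_quotient mulVg.
have Np : nbhs x [set y | N (left_quotient (x, y))] by apply: pc; rewrite xx.
have Nq : nbhs x [set y | N (left_quotient (y, x))] by apply: qc; rewrite xx.
rewrite /interior; apply: filterS (filterI Np Nq) => y [Nxy Nyx].
by apply: WA; apply/xsectionP; apply: NW.
Qed.

(** Clopen neighborhoods of 1 inside the balls of radius 1 / (n + 1). *)
Lemma left_uniformity_clopen_base : ind_zero G ->
  exists B : set_system (X * X), [/\ countable B,
    uniformity_base left_uniformity B & forall V, B V -> clopen V].
Proof.
move=> [_ [S [_ Sb] Sclopen]].
have /choice[C CP] (n : nat) : exists C : set G,
    [/\ clopen C, C 1 & C `<=` ball (n.+1%:R^-1)%R].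
  have [|C [SC C1] CB] := Sb 1 (ball (n.+1%:R^-1)%R).
    by apply: metric_ball_nbhs; rewrite invr_gt0.
  by exists C; split => //; exact: Sclopen.
have C1 n : nbhs 1 (C n).
  by have [[oC _] ? _] := CP n; exact: open_nbhs_nbhs.
exists (range (fun n => left_entourage (C n))); split.
- exact: card_image_le.
- split=> [_ [n _ <-]|V [_ [N /nbhs_metric_ball[e e0 eN] NV]]].
    exact: left_entourageE.
  have [n ne] : exists n : nat, (n.+1%:R^-1 < e)%R.
    by have [n _ /(_ n (leqnn n))] := near_infty_natSinv_lt (PosNum e0); exists n.
  exists (left_entourage (C n)); first by exists n.
  apply: subset_trans NV; apply: left_entourage_sub => z Cz.
  have [_ _ CB] := CP n; apply: eN; exact: lt_trans (CB _ Cz) ne.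
- by move=> _ [n _ <-]; apply: left_entourage_clopen; have [] := CP n.
Qed.

End GroupToUniformity.

Theorem theorem1p1 (R : realType) (X : topologicalType) :
  (exists (G : topologicalGroupType) (f : X -> G),
     [/\ metrizable R G, ind_zero G & topological_embedding f]) <->
  (exists U : set_system (X * X),
     [/\ is_uniformity U, generates_topology U &
      exists B : set_system (X * X),
        [/\ countable B, uniformity_base U B &
            forall V : set (X * X), B V -> clopen V]]).
Proof.
split=> [[G [f [[d d_metric d_open] G0 f_emb]]]|].
  exists (left_uniformity f); split.
  - exact: left_uniformity_uniformity d_metric d_open.
  - exact: left_uniformity_generates.
  - exact: left_uniformity_clopen_base d_open G0.
move=> [U [Uu Utop [B [cB bB Bclopen]]]].
have [V [V0 UV VB Vcomp Vbase]] := base_sequence Uu cB bB.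
have Vrefl n x : V n (x, x).
  by have [dV _] := uniformity_entourage Uu (UV n); exact: dV.
have Vsym n x y : V n (x, y) -> V n (y, x).
  by have [_ sV] := uniformity_entourage Uu (UV n); rewrite -{1}sV.
have Vcomp' n x y z w : V n.+1 (x, y) -> V n.+1 (y, z) -> V n.+1 (z, w) ->
    V n (x, w).
  by move=> xy yz zw; apply: Vcomp; exists z => //; exists y.
have Vsep x y : (forall n, V n (x, y)) -> x = y.
  move=> Vxy; have : (\bigcap_(W in U) W) (x, y).
    by move=> W /Vbase[n VW]; exact: VW.
  by rewrite uniformity_separated.
have Vclopen n : clopen (V n).
  by case: (VB n) => [->|/Bclopen//]; exact: clopenT.
have Vtop (A : set X) : open A <->
    forall x, A x -> exists n, forall y, V n (x, y) -> A y.
  rewrite Utop; split=> oA x /oA.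
    move=> [W /Vbase[n VW] WA]; exists n => y Vxy.
    by apply: WA; apply/xsectionP; exact: VW.
  move=> [n VA]; exists (V n) => // y /xsectionP; exact: VA.
pose g : X -> X -> R := uniform_scale V.
have gS : frink_scale g by exact: uniform_frink_scale.
have g_loc := uniform_scale_loc (R := R) V0 Vrefl Vcomp' Vsep Vclopen Vtop.
have g_top := uniform_scale_top (R := R) V0 Vrefl Vcomp' Vtop.
exists (boolean_group g), (fun x => parity [:: x]); split.
- exact: boolean_metrizable.
- exact: boolean_ind_zero.
- exact: parity_embedding.
Qed.
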